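(* Let $\mathbf{A}$ be a finite algebra. Then $\mathbf{A}$ is solvable if and only if for every neighborhood $U$ of $\mathbf{A}$ and every idempotent polynomial $p$ of the induced algebra $\mathbf{A}|_U$, the directed graph $\mathrm{Tr}(p)$ is strongly connected.
   Context: Solvability is in the sense of the (term condition) commutator of tame congruence theory: the derived series $1_{\mathbf A}\ge[1,1]\ge[[1,1],[1,1]]\ge\cdots$ reaches $0_{\mathbf A}$. A polynomial $p$ is idempotent if $p(x,\dots,x)=x$ for all $x$. A neighborhood of $\mathbf{A}$ is a set $U=e(A)$ with $e$ a unary polynomial of $\mathbf{A}$ satisfying $e(e(x))=e(x)$; the induced algebra $\mathbf{A}|_U$ has universe $U$ and as operations the restrictions to $U$ of the polynomials of $\mathbf{A}$ under which $U$ is closed. For an idempotent polynomial $p$ of an algebra with universe $B$, the translation-digraph $\mathrm{Tr}(p)$ has vertex set $B$ and directed edges $(c,\,p(c,\dots,c,d,c,\dots,c))$ for all $c,d\in B$, where $d$ occurs in exactly one (arbitrary) argument position. *)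

(* Defs.v *)
From mathcomp Require Import all_boot.
From Stdlib Require Import Relations.Relation_Operators.

Set Implicit Arguments.
Unset Strict Implicit.
Unset Printing Implicit Defensive.

Section GeneralAlgebra.
Variables (T : Type) (I : Type) (ar : I -> nat).
Variable op : forall i : I, ('I_(ar i) -> T) -> T.

Inductive term (n : nat) : Type :=
| TVar : 'I_n -> term n
| TApp : forall i : I, ('I_(ar i) -> term n) -> term n.

Fixpoint teval n (t : term n) (x : 'I_n -> T) : T :=
  match t with
  | TVar j => x j
  | TApp i args => op (fun k => teval (args k) x)
  end.

Inductive pterm (n : nat) : Type :=
| PVar : 'I_n -> pterm n
| PCst : T -> pterm n
| PApp : forall i : I, ('I_(ar i) -> pterm n) -> pterm n.

Fixpoint peval n (t : pterm n) (x : 'I_n -> T) : T :=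
  match t with
  | PVar j => x j
  | PCst c => c
  | PApp i args => op (fun k => peval (args k) x)
  end.

Definition is_poly n (f : ('I_n -> T) -> T) : Prop :=
  exists t : pterm n, forall x, f x = peval t x.

Definition idempotent_poly n (f : ('I_n -> T) -> T) : Prop :=
  forall x : T, f (fun _ => x) = x.

Definition is_cong (th : T -> T -> Prop) : Prop :=
  (forall x, th x x) /\ (forall x y, th x y -> th y x) /\
  (forall x y z, th x y -> th y z -> th x z) /\
  (forall i (x y : 'I_(ar i) -> T), (forall k, th (x k) (y k)) ->
      th (op x) (op y)).

Definition tconcat m n (a : 'I_m -> T) (c : 'I_n -> T) : 'I_(m + n) -> T :=
  fun k => match split k with inl i => a i | inr j => c j end.

Definition centralizes (alpha beta delta : T -> T -> Prop) : Prop :=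
  forall m n (t : term (m + n)) (a b : 'I_m -> T) (c d : 'I_n -> T),
    (forall k, alpha (a k) (b k)) -> (forall k, beta (c k) (d k)) ->
    delta (teval t (tconcat a c)) (teval t (tconcat a d)) ->
    delta (teval t (tconcat b c)) (teval t (tconcat b d)).

Definition commutator (alpha beta : T -> T -> Prop) : T -> T -> Prop :=
  fun x y => forall delta, is_cong delta -> centralizes alpha beta delta ->
                           delta x y.

Fixpoint derived (k : nat) : T -> T -> Prop :=
  match k with
  | 0 => fun _ _ => True
  | k'.+1 => commutator (derived k') (derived k')
  end.

Definition solvable : Prop :=
  exists k, forall x y, derived k x y <-> x = y.

Definition tr_edge n (p : ('I_n -> T) -> T) (c v : T) : Prop :=
  exists (j : 'I_n) (d : T), v = p (fun k => if k == j then d else c).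

Definition strongly_connected (E : T -> T -> Prop) : Prop :=
  forall u v, clos_refl_trans T E u v.

End GeneralAlgebra.

Section Induced.
Variables (A : finType) (I : Type) (ar : I -> nat).
Variable op : forall i : I, ('I_(ar i) -> A) -> A.

Definition nbhd_map (e : A -> A) : Prop :=
  is_poly op (fun x : 'I_1 -> A => e (x ord0)) /\ (forall x, e (e x) = e x).

Definition nbhd (e : A -> A) : {set A} := [set e x | x : A].

Definition preserves (U : {set A}) n (f : ('I_n -> A) -> A) : Prop :=
  forall x : 'I_n -> A, (forall k, x k \in U) -> f x \in U.

Definition ind_carrier (U : {set A}) : Type := {a : A | a \in U}.

Definition ind_idx (U : {set A}) : Type :=
  {n : nat & {f : ('I_n -> A) -> A | is_poly op f /\ preserves U f}}.

Definition ind_ar (U : {set A}) (s : ind_idx U) : nat := projT1 s.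

Definition ind_op (U : {set A}) (s : ind_idx U)
    (x : 'I_(ind_ar s) -> ind_carrier U) : ind_carrier U :=
  exist (fun a => a \in U) (sval (projT2 s) (fun k => sval (x k)))
        (proj2 (svalP (projT2 s)) (fun k => sval (x k)) (fun k => svalP (x k))).

End Induced.

(* Main.v *)
(** Solvability is equivalent to the absence of snags: binary polynomials [s]
    and [a <> b] with [s a a = s a b = s b a = a] and [s b b = b].  A solvable
    algebra has none, since the term condition pushes [(a, b)] down the derived
    series.

    A snag, iterated on a neighborhood [V] that is minimal among those
    containing [a] and [b], yields an idempotent [q] with
    [q x (q x y) = q x y], [q b y = y] and [q x b] a permutation of [V] in [x];
    then [q x y = b] only for [x = y = b], so [b] cannot be reached from [a].

    Conversely let [al < be] be a covering pair of congruences and [V = e(A)] a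
    minimal neighborhood on which they differ.  Unary polynomials into [V] either
    permute [V] or collapse [be] into [al] on [V]; from this, a failure of the
    term condition for a binary polynomial on [V] produces a snag, and the full
    term condition [C(be, be; al)] follows from the binary one.  Hence without
    snags the derived series descends to equality.

    For connectedness of [Tr(p)], take a cover [al < be] with [al], but not [be],
    inside mutual reachability.  Edges between [be]-related points are reversible
    up to [al].  Let [F] be an idempotent polynomial whose image on tuples from
    a trace [N] of [be] on [V] is as large as possible: this image [W] contains
    [N], and every value of [p(F, .., F)] on [N] lies in [W].  Rewriting such a
    value [b] as [p(b, .., b)] with [b] in [W], the change of a single argument
    from [N] becomes, modulo [al], an edge of [Tr(p)]; so all of [N] is
    connected, and translates of such traces generate [be] over [al]. *)
Require Import Defs.
From mathcomp Require Import all_boot.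
From mathcomp Require Import boolp.
From Stdlib Require Import Relations.Relation_Operators.

Set Implicit Arguments.
Unset Strict Implicit.
Unset Printing Implicit Defensive.

(** * Minimal choices, one-coordinate changes and iterates of finite self-maps *)

Section Preliminaries.

Lemma ex_min_measure (S : Type) (P : S -> Prop) (mu : S -> nat) :
  (exists x, P x) -> exists2 x, P x & forall y, P y -> mu x <= mu y.
Proof.
move=> [x0 Px0].
have ex : exists n, `[< exists2 x, P x & mu x = n >].
  by exists (mu x0); apply/asboolP; exists x0.
case: (ex_minnP ex) => n /asboolP[x Px <-] minx.
by exists x => // y Py; apply: minx; apply/asboolP; exists y.
Qed.

Definition upd (X : eqType) (U : Type) (v : X -> U) (k : X) (a : U) : X -> U :=
  fun j => if j == k then a else v j.

Lemma upd_same (X : eqType) (U : Type) (v : X -> U) k : upd v k (v k) = v.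
Proof. by apply: funext => j; rewrite /upd; case: eqP => [->|]. Qed.

Lemma upd_ind (X : finType) (U : Type) (x y : X -> U) (P : (X -> U) -> Prop) :
  P x ->
  (forall v k, (forall j, v j = x j \/ v j = y j) -> v k = x k -> P v ->
     P (upd v k (y k))) ->
  P y.
Proof.
move=> Px step.
pose mix (s : seq X) j := if j \in s then y j else x j.
have Pmix s : P (mix s).
  elim: s => [|k s IH]; first by rewrite (_ : mix [::] = x).
  case ks: (k \in s).
    rewrite (_ : mix (k :: s) = mix s) //; apply: funext => j.
    by rewrite /mix inE; case: eqP => // ->; rewrite ks.
  rewrite (_ : mix (k :: s) = upd (mix s) k (y k)); last first.
    by apply: funext => j; rewrite /mix /upd inE; case: eqP => // ->.
  apply: step => // [j|]; last by rewrite /mix ks.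
  by rewrite /mix; case: ifP; [right|left].
have := Pmix (enum X); rewrite (_ : mix (enum X) = y) //.
by apply: funext => j; rewrite /mix mem_enum.
Qed.

Variable T : finType.

(** The factorial is a multiple of every cycle length and bounds every pre-period, so this single
    exponent makes iterates of all self-maps idempotent; where [iter period f] is the identity,
    [iter period.-1 f] inverts [f]. *)
Definition period : nat := #|T|`!.

Lemma period_gt0 : 0 < period. Proof. exact: fact_gt0. Qed.

Lemma iter_periodS (f : T -> T) x : iter period.-1 f (f x) = iter period f x.
Proof. by rewrite -iterSr prednK // period_gt0. Qed.

Lemma iter_period_idem (f : T -> T) x :
  iter period f (iter period f x) = iter period f x.
Proof.
have /trajectP[i lt_i eq_i] := looping_order f x.
have le_o : fingraph.order f x <= #|T| by apply: max_card.
have le_N : #|T| <= period.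
  have T0 : 0 < #|T| by apply/card_gt0P; exists x.
  by apply: dvdn_leq; [exact: period_gt0 | apply: dvdn_fact; rewrite T0 leqnn].
set q := fingraph.order f x - i.
have q0 : 0 < q by rewrite subn_gt0.
have qN : q %| period.
  by apply: dvdn_fact; rewrite q0 (leq_trans (leq_subr _ _)).
have stepq m : i <= m -> iter (m + q) f x = iter m f x.
  move=> /subnK <-; rewrite -addnA (subnKC (ltnW lt_i)).
  by rewrite !iterD eq_i.
have stepk k m : i <= m -> iter (m + k * q) f x = iter m f x.
  elim: k => [|k IH] im; first by rewrite mul0n addn0.
  by rewrite mulSn addnCA addnC stepq ?IH // (leq_trans im) ?leq_addr.
rewrite -iterD; case/dvdnP: qN => k Ek; rewrite {2}Ek.
by apply: stepk; rewrite (leq_trans (ltnW lt_i)) // (leq_trans le_o).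
Qed.

(* On the image of an idempotent map, a self-map that is injective there is
   inverted by its [period.-1]-st power. *)
Lemma iter_period_inj (e g : T -> T) :
  (forall x, e (g x) = g x) ->
  (forall x y, e x = x -> e y = y -> g x = g y -> x = y) ->
  forall x, e x = x -> iter period g x = x.
Proof.
move=> eg ginj x ex.
have Vit n y : e y = y -> e (iter n g y) = iter n g y.
  by case: n => // n _; rewrite iterS eg.
have inj_it n y z : e y = y -> e z = z -> iter n g y = iter n g z -> y = z.
  elim: n => // n IH ey ez; rewrite !iterS => /ginj E; apply: IH => //.
  by apply: E; apply: Vit.
by apply: (inj_it period) => //; [apply: Vit | apply: iter_period_idem].
Qed.

Lemma iter_fix (g : T -> T) n x : g x = x -> iter n g x = x.
Proof. by move=> gx; elim: n => //= n ->. Qed.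

Lemma iter_into (e g : T -> T) n x :
  (forall y, e (g y) = g y) -> e x = x -> e (iter n g x) = iter n g x.
Proof. by move=> eg ex; case: n => // n; rewrite iterS eg. Qed.

Definition rcard (R : T -> T -> Prop) : nat :=
  #|[set z : T * T | `[< R z.1 z.2 >]]|.

Lemma rcard_sub_eq (R R' : T -> T -> Prop) :
  (forall x y, R x y -> R' x y) -> rcard R' <= rcard R ->
  forall x y, R' x y -> R x y.
Proof.
move=> sub le x y Rxy.
have /eqP E : [set z : T * T | `[< R z.1 z.2 >]]
            == [set z : T * T | `[< R' z.1 z.2 >]].
  rewrite eqEcard le andbT; apply/subsetP => z.
  by rewrite !inE => /asboolP H; apply/asboolP; apply: sub.
have : (x, y) \in [set z : T * T | `[< R' z.1 z.2 >]].
  by rewrite inE; apply/asboolP.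
by rewrite -E inE => /asboolP.
Qed.

End Preliminaries.

(** * Polynomials and snags *)

Section Polynomials.
Variables (T : finType) (I : Type) (ar : I -> nat).
Variable op : forall i : I, ('I_(ar i) -> T) -> T.

(** A predicate on functions with any type of variables, so that blocks of arguments can be indexed
    by sums, products or option types. *)
Inductive poly (X : Type) : ((X -> T) -> T) -> Prop :=
| PolyVar x : poly (fun v => v x)
| PolyCst a : poly (fun=> a)
| PolyApp i (G : 'I_(ar i) -> (X -> T) -> T) :
    (forall k, poly (G k)) -> poly (fun v => op (fun k => G k v)).

(* An operation with argument block [Y] (or two blocks, or one or two single
   arguments) is a polynomial when it maps polynomials in any environment to
   polynomials; this form makes substitution immediate. *)
Definition polX (Y : Type) (S : (Y -> T) -> T) : Prop :=
  forall (X : Type) (G : Y -> (X -> T) -> T),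
    (forall y, poly (G y)) -> poly (fun v => S (fun y => G y v)).

Definition polXX (Z Y : Type) (S : (Z -> T) -> (Y -> T) -> T) : Prop :=
  forall (X : Type) (F : Z -> (X -> T) -> T) (G : Y -> (X -> T) -> T),
    (forall z, poly (F z)) -> (forall y, poly (G y)) ->
    poly (fun v => S (fun z => F z v) (fun y => G y v)).

Definition pol1X (Y : Type) (S : T -> (Y -> T) -> T) : Prop :=
  forall (X : Type) (F : (X -> T) -> T) (G : Y -> (X -> T) -> T),
    poly F -> (forall y, poly (G y)) ->
    poly (fun v => S (F v) (fun y => G y v)).

Definition pol1 (g : T -> T) : Prop :=
  forall (X : Type) (F : (X -> T) -> T), poly F -> poly (fun v => g (F v)).

Definition pol2 (s : T -> T -> T) : Prop :=
  forall (X : Type) (F G : (X -> T) -> T),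
    poly F -> poly G -> poly (fun v => s (F v) (G v)).

Lemma poly_polX (Y : Type) (S : (Y -> T) -> T) : poly S -> polX S.
Proof.
move=> pS X G pG; elim: pS => [y|a|i H _ IH]; [exact: pG|exact: PolyCst|].
by apply: (PolyApp (G := fun k v => H k (fun y => G y v))).
Qed.

Lemma polX_poly (Y : Type) (S : (Y -> T) -> T) : polX S -> poly S.
Proof. by move=> pS; apply: (pS Y (fun y v => v y)) => y; exact: PolyVar. Qed.

Lemma poly_iter (X : Type) (s : (X -> T) -> T -> T) (F : (X -> T) -> T) n :
  (forall G : (X -> T) -> T, poly G -> poly (fun v => s v (G v))) ->
  poly F -> poly (fun v => iter n (s v) (F v)).
Proof. by move=> ps pF; elim: n => [|n IH] //=; apply: (ps _ IH). Qed.

Section Congruences.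
Variable th : T -> T -> Prop.
Hypothesis th_cong : is_cong op th.

Lemma poly_cong (X : Type) (F : (X -> T) -> T) v w :
  poly F -> (forall x, th (v x) (w x)) -> th (F v) (F w).
Proof.
case: th_cong => thr [_ [_ thop]] pF vw.
by elim: pF => [x|a|i G _ IH]; [exact: vw|exact: thr|apply: thop].
Qed.

Lemma pol1_cong g x y : pol1 g -> th x y -> th (g x) (g y).
Proof.
move=> pg xy.
have pG : poly (fun v : unit -> T => g (v tt)) by apply: pg; exact: PolyVar.
exact: (poly_cong (v := fun=> x) (w := fun=> y) pG).
Qed.

Lemma pol2_cong s x y x' y' :
  pol2 s -> th x y -> th x' y' -> th (s x x') (s y y').
Proof.
move=> ps xy xy'.
have pS : poly (fun v : bool -> T => s (v true) (v false)).
  by apply: ps; exact: PolyVar.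
apply: (poly_cong (v := fun b : bool => if b then x else x')
                  (w := fun b : bool => if b then y else y') pS).
by case.
Qed.

Lemma polX_cong (Y : Type) (S : (Y -> T) -> T) v w :
  polX S -> (forall x, th (v x) (w x)) -> th (S v) (S w).
Proof. by move=> /polX_poly; apply: poly_cong. Qed.

Lemma pol1X_cong (Y : Type) (S : T -> (Y -> T) -> T) x y v w :
  pol1X S -> th x y -> (forall j, th (v j) (w j)) -> th (S x v) (S y w).
Proof.
move=> pS xy vw.
have pF : poly (fun u : option Y -> T => S (u None) (fun j => u (Some j))).
  by apply: pS => [|j]; exact: PolyVar.
apply: (poly_cong (v := fun o => if o is Some j then v j else x)
                  (w := fun o => if o is Some j then w j else y) pF).
by case.
Qed.

End Congruences.

Lemma pol1_id : pol1 id. Proof. by []. Qed.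

Lemma pol1_comp g h : pol1 g -> pol1 h -> pol1 (fun x => g (h x)).
Proof. by move=> pg ph X F pF; apply: (pg _ (fun v => h (F v))); apply: ph. Qed.

Lemma pol1_iter g n : pol1 g -> pol1 (iter n g).
Proof.
move=> pg X F pF; apply: (poly_iter (s := fun=> g)) => // G pG; exact: pg.
Qed.

Definition snag : Prop :=
  exists s a b, [/\ pol2 s, a <> b, s a a = a, s a b = a &
    s b a = a /\ s b b = b].

End Polynomials.

Ltac poly_upd :=
  rewrite /upd; repeat case: (_ == _); first [exact: PolyCst | by []].

(** * Minimal neighborhoods of a covering pair of congruences *)

Section Cover.
Variables (T : finType) (I : Type) (ar : I -> nat).
Variable op : forall i : I, ('I_(ar i) -> T) -> T.
Variables al be : T -> T -> Prop.

Record covers : Prop := Covers {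
  covers_cong_lo : is_cong op al;
  covers_cong_hi : is_cong op be;
  covers_sub : forall x y, al x y -> be x y;
  covers_strict : exists x y, be x y /\ ~ al x y;
  covers_gap : forall ga, is_cong op ga ->
    (forall x y, al x y -> ga x y) -> (forall x y, ga x y -> be x y) ->
    (forall x y, ga x y -> al x y) \/ (forall x y, be x y -> ga x y) }.

Hypothesis cov : covers.

Let alC : is_cong op al := covers_cong_lo cov.
Let beC : is_cong op be := covers_cong_hi cov.
Let alr x : al x x. Proof. by case: alC. Qed.
Let als x y : al x y -> al y x. Proof. by case: alC => _ [H _]; exact: H. Qed.
Let alt y x z : al x y -> al y z -> al x z.
Proof. by case: alC => _ [_ [H _]]; exact: H. Qed.
Let ber x : be x x. Proof. by case: beC. Qed.
Let bes x y : be x y -> be y x. Proof. by case: beC => _ [H _]; exact: H. Qed.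
Let bet y x z : be x y -> be y z -> be x z.
Proof. by case: beC => _ [_ [H _]]; exact: H. Qed.
Let albe x y : al x y -> be x y. Proof. exact: (covers_sub cov). Qed.

Let pol1 := @pol1 T I ar op.
Let pol2 := @pol2 T I ar op.
Let N := period T.

(** The [be]-pairs whose images under all unary polynomials lie in [Q] form a congruence between
    [al] and [be]. *)
Lemma cover_dichotomy (Q : T -> T -> Prop) :
  (forall x, Q x x) -> (forall x y, Q x y -> Q y x) ->
  (forall x y z, Q x y -> Q y z -> Q x z) -> (forall x y, al x y -> Q x y) ->
  (forall x y, be x y -> (forall g, pol1 g -> Q (g x) (g y)) -> al x y)
  \/ (forall x y, be x y -> Q x y).
Proof.
move=> Qr Qs Qt alQ.
pose ga x y := be x y /\ forall g, pol1 g -> Q (g x) (g y).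
have gaC : is_cong op ga.
  split; [by move=> x; split|split; [|split]].
  - by move=> x y [bxy H]; split=> [|g pg]; [exact: bes|exact/Qs/H].
  - move=> x y z [bxy H] [byz H']; split=> [|g pg]; first exact: bet byz.
    exact: Qt (H g pg) (H' g pg).
  - move=> i x y xy; split.
      by case: beC => _ [_ [_ H]]; apply: H => k; case: (xy k).
    move=> g pg; apply: (upd_ind (P := fun v => Q (g (op x)) (g (op v)))) => //.
    move=> v k _ vk IH; apply: (Qt _ _ _ IH).
    have E : v = upd v k (x k) by rewrite -vk upd_same.
    rewrite [in X in Q X]E.
    case: (xy k) => _ /(_ (fun z => g (op (upd v k z)))); apply=> X F pF.
    apply: (pg _ (fun w => op (upd v k (F w)))).
    apply: PolyApp => j; poly_upd.
case: (covers_gap cov gaC) => [x y xy|x y []//|H|H].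
- by split=> [|g pg]; [exact: albe|exact/alQ/(pol1_cong alC pg xy)].
- by left=> x y bxy H'; apply: H.
- by right=> x y /H[_ /(_ id)]; apply; exact: pol1_id.
Qed.

Definition separates (f : T -> T) : Prop :=
  exists x y, be x y /\ ~ al (f x) (f y).

Record minimal_idem (e : T -> T) : Prop := MinimalIdem {
  mi_pol : pol1 e;
  mi_idem : forall x, e (e x) = e x;
  mi_sep : separates e;
  mi_min : forall f, pol1 f -> separates f ->
    #|[set e x | x : T]| <= #|[set f x | x : T]| }.

(** The dichotomy is applied to the preimage of [al] under [f], which cannot contain [be]. *)
Lemma separate_again f x y :
  pol1 f -> separates f -> be x y -> ~ al x y ->
  exists2 g, pol1 g & ~ al (f (g x)) (f (g y)).
Proof.
move=> pf [u [v [buv nuv]]] bxy nxy; apply: contrapT => nog.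
have [x0|x0 y0|x0 y0 z0|x0 y0|H|H] :=
    @cover_dichotomy (fun x y => al (f x) (f y)).
- exact: alr.
- exact: als.
- exact: alt.
- exact: (pol1_cong alC pf).
- apply: nxy; apply: H => // g pg.
  by apply: contrapT => ng; apply: nog; exists g.
- exact/nuv/H.
Qed.

(** In the other case of the dichotomy, [e] would collapse [be] into [al]. *)
Lemma cover_generated e (Q : T -> T -> Prop) :
  separates e -> (forall z, e (e z) = e z) -> pol1 e ->
  (forall x, Q x x) -> (forall x y, Q x y -> Q y x) ->
  (forall x y z, Q x y -> Q y z -> Q x z) -> (forall x y, al x y -> Q x y) ->
  (forall g x y, pol1 g -> e x = x -> e y = y -> be x y -> Q (g x) (g y)) ->
  forall x y, be x y -> Q x y.
Proof.
move=> [u [v [buv nuv]]] ee pe Qr Qs Qt alQ Qgen.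
case: (cover_dichotomy Qr Qs Qt alQ) => // H; case: nuv; apply: H.
  exact: (pol1_cong beC).
by move=> g pg; apply: Qgen; rewrite ?ee //; exact: (pol1_cong beC).
Qed.

(** A separating [f] of smallest image need not be idempotent, but some [g] keeps [f (g (f x))]
    separating. Then [f] after [g] permutes the image of [f], and a power of it is an idempotent map
    onto that image. *)
Lemma minimal_idem_exists : exists e, minimal_idem e.
Proof.
have [|f [pf sf] fmin] := @ex_min_measure _
  (fun f => pol1 f /\ separates f) (fun f => #|[set f x | x : T]|).
  by exists id; split; [exact: pol1_id|exact: (covers_strict cov)].
have [u [v [buv nuv]]] := sf.
have [g pg ng] := separate_again pf sf (pol1_cong beC pf buv) nuv.
pose h z := f (g z).
have ph : pol1 h := pol1_comp pf pg.
have sfh : separates (fun x => h (f x)) by exists u, v.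
have imh : [set h (f x) | x : T] = [set f x | x : T].
  apply/eqP; rewrite eqEcard fmin ?andbT; last by split=> //; exact: pol1_comp.
  by apply/subsetP => _ /imsetP[x _ ->]; apply: imset_f.
have hinj : forall x y, h (f x) = h (f y) -> f x = f y.
  have /imset_injP hi : #|[set h y | y in [set f x | x : T]]| ==
                       #|[set f x | x : T]|.
    by rewrite -[in X in _ == X]imh -imset_comp.
  by move=> x y; apply: hi; apply: imset_f.
have hit n x y : iter n h (f x) = iter n h (f y) -> f x = f y.
  elim: n x y => // n IH x y; rewrite !iterSr => E.
  by apply: hinj; apply: IH; exact: E.
have hf n x : exists y, iter n h (f x) = f y.
  by case: n => [|n]; [exists x|exists (g (iter n h (f x)))].
have hN x : iter N h (f x) = f x.
  have [y Ey] := hf N x; rewrite Ey.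
  by apply: (hit N); rewrite -Ey iter_period_idem.
exists (iter N h); split.
- exact: pol1_iter.
- exact: iter_period_idem.
- exists (f u), (f v); rewrite !hN; split=> //; exact: (pol1_cong beC).
- move=> f' pf' sf'; apply: leq_trans (fmin f' _) => //.
  apply/subset_leq_card/subsetP => _ /imsetP[x _ ->].
  rewrite /N -iter_periodS; have [y ->] := hf (period T).-1 (g x).
  exact: imset_f.
Qed.

(** Minimality makes [g] map the image [V] of [e] onto itself, hence injectively. *)
Lemma pol_perm e g x y : minimal_idem e -> pol1 g ->
  (forall z, e (g z) = g z) -> e x = x -> e y = y -> be x y ->
  ~ al (g x) (g y) -> forall z, e z = z -> iter N g z = z.
Proof.
move=> [pe ee se emin] pg eg ex ey bxy nxy; apply: iter_period_inj => //.
have sub : [set g (e z) | z : T] \subset [set e z | z : T].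
  by apply/subsetP => _ /imsetP[z _ ->]; rewrite -eg; apply: imset_f.
have /eqP im : [set g (e z) | z : T] == [set e z | z : T].
  rewrite eqEcard sub emin //; first exact: (pol1_comp pg pe).
  by exists x, y; rewrite ex ey.
have /imset_injP gi : #|[set g z | z in [set e z | z : T]]| ==
                      #|[set e z | z : T]|.
  by rewrite -[in X in _ == X]im -imset_comp.
by move=> a b ea eb; apply: gi; [rewrite -ea|rewrite -eb]; apply: imset_f.
Qed.

Lemma minimal_separates e x y : minimal_idem e -> be x y ->
  (forall f, pol1 f -> (forall z, e (f z) = f z) -> al (f x) (f y)) -> al x y.
Proof.
move=> [pe ee se _] bxy H; apply: contrapT => nxy.
have [g pg []] := separate_again pe se bxy nxy.
by apply: (H (fun z => e (g z))); [exact: pol1_comp|move=> z; exact: ee].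
Qed.

Definition single_tc (e : T -> T) : Prop :=
  forall s, pol2 s -> (forall y z, e (s y z) = s y z) ->
  forall a b c d, e a = a -> e b = b -> e c = c -> e d = d ->
    be a b -> be c d -> al (s a c) (s a d) -> al (s b c) (s b d).

Lemma single_tc_of_no_snag e : minimal_idem e -> ~ snag op -> single_tc e.
Proof.
move=> me nosnag s ps es a b c d Va Vb Vc Vd ab cd sac.
apply: contrapT => nsb.
have psb y : pol1 (s y) by move=> X F pF; apply: ps => //; exact: PolyCst.
(* The failure makes [s b] a permutation of [V]; undoing it turns [s1 b] into the identity there. *)
pose s1 y z := iter N.-1 (s b) (s y z).
have ps1 : pol2 s1.
  move=> X F G pF pG; apply: (poly_iter (s := fun=> s b)); last exact: ps.
  by move=> G'; apply: psb.
have es1 y z : e (s1 y z) = s1 y z by apply: iter_into.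
have s1b z : e z = z -> s1 b z = z.
  by rewrite /s1 iter_periodS; apply: (pol_perm me (psb b) _ Vc Vd cd nsb).
(* Iteration makes [s2 a] idempotent and leaves [s2 b] the identity on [V]. *)
pose s2 y z := iter N (s1 y) z.
have ps2 : pol2 s2.
  move=> X F G pF pG; apply: (poly_iter (s := fun v => s1 (F v))) => // G'.
  exact: ps1.
have es2 y z : e (s2 y z) = s2 y z.
  by rewrite /s2 /N -iter_periodS iter_into.
have s2b z : e z = z -> s2 b z = z by move=> Vz; apply/iter_fix/s1b.
have s2i y z : s2 y (s2 y z) = s2 y z by apply: iter_period_idem.
have ps1a : pol1 (s1 a) by move=> X F pF; apply: ps1 => //; exact: PolyCst.
have s2ac : al (s2 a c) (s2 a d).
  rewrite /s2 /N -!iter_periodS; apply: (pol1_cong alC (pol1_iter _ ps1a)).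
  exact: (pol1_cong alC (pol1_iter _ (psb b))).
have [x [Vx nx]] : exists x, e x = x /\ ~ al x (s2 a x).
  apply: contrapT => nox; apply: nsb; apply: (pol1_cong alC (psb b)).
  apply: (alt (y := s2 a c)).
    by apply: contrapT => H; apply: nox; exists c.
  apply: (alt s2ac); apply: als.
  by apply: contrapT => H; apply: nox; exists d.
(* [pi] sends [b] to [x] and [a] to [s2 a x], which are not [al]-related, so it permutes [V].
   Undoing it in the first argument of [s2] yields a snag on [s2 a x] and [x]. *)
pose pi y := s2 y x.
have ppi : pol1 pi by move=> X F pF; apply: ps2 => //; exact: PolyCst.
have piN z : e z = z -> iter N pi z = z.
  apply: (pol_perm me ppi _ Vb Va (bes ab)); first by move=> y; apply: es2.
  by rewrite /pi s2b.
pose s3 y z := s2 (iter N.-1 pi y) z.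
have ps3 : pol2 s3.
  by move=> X F G pF pG; apply: ps2 => //; exact: (pol1_iter _ ppi).
have s3a z : s3 (s2 a x) z = s2 a z.
  by rewrite /s3 -/(pi a) iter_periodS piN.
have s3b z : e z = z -> s3 x z = z.
  move=> Vz; have {1}<- : pi b = x by apply: s2b.
  by rewrite /s3 iter_periodS piN ?s2b.
apply: nosnag; exists s3, (s2 a x), x; split=> //.
- by move=> E; apply: nx; rewrite E.
- by rewrite s3a s2i.
- by rewrite s3b ?s3b.
Qed.

(** * The term condition without snags *)

Section TermCondition.
Variable e : T -> T.
Hypothesis me : minimal_idem e.
Hypothesis tc : single_tc e.

(** Either every coordinate collapses [be] into [al], and [c] can be changed into [d] one coordinate
    at a time, or some coordinate [j] permutes [V] and can be solved for. *)
Lemma tuple_tc (X : finType) (s : T -> (X -> T) -> T) a b (c d : X -> T) :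
  pol1X op s -> (forall y v, e (s y v) = s y v) ->
  e a = a -> e b = b -> (forall j, e (c j) = c j) -> (forall j, e (d j) = d j) ->
  be a b -> (forall j, be (c j) (d j)) ->
  al (s a c) (s a d) -> al (s b c) (s b d).
Proof.
move=> ps es Va Vb Vc Vd ab cd sac.
pose between (v : X -> T) := forall j, v j = c j \/ v j = d j.
have betV v : between v -> forall j, e (v j) = v j.
  by move=> bv j; case: (bv j) => ->.
have betbe v : between v -> forall j, be (c j) (v j).
  by move=> bv j; case: (bv j) => ->.
pose coll j y v := forall u u', e u = u -> e u' = u' -> be u u' ->
  al (s y (upd v j u)) (s y (upd v j u')).
(* By the binary condition, collapsing in coordinate [j] depends neither on the first argument
   within its [be]-class nor on the other coordinates. *)
have coll_move j y y' v v' : e y = y -> e y' = y' -> be y y' ->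
    between v -> between v' -> coll j y v -> coll j y' v'.
  move=> Vy Vy' yy' bv bv' H u u' Vu Vu' uu'.
  apply: (upd_ind (x := v) (y := v')
    (P := fun v => al (s y' (upd v j u)) (s y' (upd v j u')))).
    apply: (tc (s := fun y z => s y (upd v j z)) _ _ Vy Vy' Vu Vu' yy' uu').
    - move=> Y F G pF pG; apply: ps => // ?; poly_upd.
    - by [].
    - exact: H.
  move=> w k bw wk; rewrite -{1 2}(upd_same w k).
  have wk' : be (w k) (v' k).
    by rewrite wk; apply: bet (betbe _ bv' k); apply/bes/betbe.
  apply: (tc (s := fun z' z => s y' (upd (upd w k z') j z))
            _ _ _ _ Vu Vu' wk' uu').
  - move=> Y F G pF pG; apply: ps => [|i]; first exact: PolyCst.
    poly_upd.
  - by [].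
  - by rewrite wk betV.
  - exact: betV.
have bc : between c by left.
have bd : between d by right.
have [allcoll|/existsNP[j ncoll]] := EM (forall j, coll j a c).
  apply: (upd_ind (x := c) (y := d) (P := fun v => al (s b c) (s b v))) => //.
  move=> v k bv vk IH; apply: (alt IH); rewrite -{1}(upd_same v k).
  apply: (coll_move k a b c v) => //; rewrite vk //; exact: cd.
have perm y v : e y = y -> be a y -> between v ->
    forall z, e z = z -> iter N (fun z => s y (upd v j z)) z = z.
  move=> Vy ay bv.
  have /existsNP[u /existsNP[u' H]] : ~ coll j y v.
    by move=> H; apply: ncoll; apply: coll_move H => //; apply: bes.
  move: H => /not_implyP[Vu /not_implyP[Vu' /not_implyP[uu' H]]].
  apply: (pol_perm me _ _ Vu Vu' uu' H); last by [].
  move=> Y F pF; apply: ps => [|i]; first exact: PolyCst.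
  by poly_upd.
(* [H y v] is the value of coordinate [j] at which [s y] on [v] equals [s y c]. Both [H a] and [H b]
   start at [c j]; the binary condition, with [y] as second argument, keeps them [al]-related on the
   way to [d]. *)
pose H y v := iter N.-1 (fun z => s y (upd v j z)) (s y c).
have Hc y : e y = y -> be a y -> H y c = c j.
  move=> Vy ay; rewrite /H -{2}(upd_same c j).
  by rewrite (iter_periodS (fun z => s y (upd c j z))) perm.
have Hab : al (H a d) (H b d).
  apply: (upd_ind (x := c) (y := d) (P := fun v => al (H a v) (H b v))).
    by rewrite !Hc.
  move=> v k bv vk; rewrite -{1 2}(upd_same v k) vk.
  apply: (tc (s := fun z y => H y (upd v k z))) => //.
    move=> Y F G pF pG; apply: (poly_iter
        (s := fun w z => s (G w) (upd (upd v k (F w)) j z))).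
      move=> G' pG'; apply: ps => // i.
      by poly_upd.
    by apply: ps => // ?; exact: PolyCst.
  by move=> y z; apply: iter_into.
have Had : al (H a d) (d j).
  have pit : pol1 (iter N.-1 (fun z => s a (upd d j z))).
    apply: pol1_iter => Y F pF; apply: ps => [|i]; first exact: PolyCst.
    by poly_upd.
  apply: (alt (pol1_cong alC pit sac)).
  rewrite -{2}(upd_same d j) (iter_periodS (fun z => s a (upd d j z))).
  by rewrite perm.
have {Hab Had}Hbd : al (H b d) (d j) by apply: alt Had; apply: als.
have pbd : pol1 (fun z => s b (upd d j z)).
  move=> Y F pF; apply: ps => [|i]; first exact: PolyCst.
  by poly_upd.
have := pol1_cong alC pbd Hbd; rewrite upd_same /H.
rewrite -(iterS _ (fun z => s b (upd d j z))) prednK ?period_gt0 //.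
by rewrite perm.
Qed.

Definition essential (h : T -> T) : Prop :=
  exists x y, [/\ e x = x, e y = y, be x y & ~ al (h x) (h y)].

(* Modulo [al], [h1] is [h2] composed with a map that can be deformed to the
   identity of [V] by moving parameters in [V] along [be]. *)
Definition linked (h1 h2 : T -> T) : Prop :=
  essential h1 -> essential h2 /\
  exists (X : finType) (P : T -> (X -> T) -> T) (x x' : X -> T),
    [/\ pol1X op P, forall y v, e (P y v) = P y v,
        (forall j, e (x j) = x j) /\ (forall j, e (x' j) = x' j),
        forall j, be (x j) (x' j) &
        forall y, e y = y -> P y x' = y /\ al (h2 (P y x)) (h1 y)].

Lemma linked_al h1 h2 : (forall y, al (h1 y) (h2 y)) -> linked h1 h2.
Proof.
move=> h12 [u [u' [Vu Vu' uu' H]]]; split.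
  exists u, u'; split=> // H'; apply: H.
  by apply: alt (h12 u) _; apply: alt H' _; apply: als.
exists void, (fun y _ => e y), (fun=> u), (fun=> u); split=> //.
- by move=> X F G pF _; apply: (mi_pol me).
- by move=> y v; apply: (mi_idem me).
- by move=> y ->; split=> //; apply: als.
Qed.

Lemma linked_trans h1 h2 h3 : linked h1 h2 -> linked h2 h3 -> linked h1 h3.
Proof.
move=> L12 L23 /L12[/L23[e3 [X' [P' [z [z' [pP' eP' [Vz Vz'] zz' HP']]]]]]].
move=> [X [P [x [x' [pP eP [Vx Vx'] xx' HP]]]]]; split=> //.
pose glue (v : X -> T) (v' : X' -> T) (o : X + X') :=
  match o with inl j => v j | inr j => v' j end.
exists (X + X')%type,
  (fun y v => P' (P y (fun j => v (inl j))) (fun j => v (inr j))),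
  (glue x z), (glue x' z'); split.
- by move=> Y F G pF pG; apply: pP' => //; apply: pP.
- by [].
- by split; case.
- by case.
- move=> y Vy; have [Px' Px] := HP _ Vy; split=> /=.
    by rewrite Px'; case: (HP' _ Vy).
  by apply: alt Px; case: (HP' (P y x)).
Qed.

(** It suffices to treat translates [g x] and [g x'] of points of [V]. There [P y v] is the inverse
    of [s^~ (g x')] at [s y (g v)], which is [y] for [v = x']. *)
Lemma linked_params (s : T -> T -> T) c d :
  pol2 s -> (forall y z, e (s y z) = s y z) -> be c d ->
  linked (s^~ c) (s^~ d).
Proof.
move=> ps es cd.
have stepV g x x' : pol1 g -> e x = x -> e x' = x' -> be x x' ->
    linked (s^~ (g x)) (s^~ (g x')).
  move=> pg Vx Vx' xx' [u [u' [Vu Vu' uu' H]]].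
  have H' : ~ al (s u (g x')) (s u' (g x')).
    move=> H'; apply: H.
    apply: (tc (s := fun y z => s z (g y)) _ _ Vx' Vx Vu Vu' _ uu' H') => //.
      by move=> X F G pF pG; apply: ps => //; apply: pg.
    exact: bes.
  have ps' : pol1 (s^~ (g x')).
    by move=> X F pF; apply: ps => //; exact: PolyCst.
  split; first by exists u, u'.
  exists unit, (fun y v => iter N.-1 (s^~ (g x')) (s y (g (v tt)))),
    (fun=> x), (fun=> x').
  have sN := pol_perm me ps' (es^~ _) Vu Vu' uu' H'.
  split=> //.
  - move=> X F G pF pG; apply: (poly_iter (s := fun _ y => s y (g x'))).
      by move=> G'; apply: ps'.
    by apply: ps => //; apply: pg.
  - by move=> y v; apply: iter_into.
  - move=> y Vy; split; first by rewrite (iter_periodS (s^~ (g x'))) sN.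
    rewrite -(iterS _ (s^~ (g x'))) prednK ?period_gt0 // sN //; exact: alr.
apply: (proj1 (@cover_generated e
  (fun c d => linked (s^~ c) (s^~ d) /\ linked (s^~ d) (s^~ c))
  (mi_sep me) (mi_idem me) (mi_pol me) _ _ _ _ _ c d cd)).
- by move=> x; split; apply: linked_al => y; apply: alr.
- by move=> x y [].
- move=> x y z [L1 L2] [L3 L4].
  by split; [apply: linked_trans L3|apply: linked_trans L2].
- move=> x y xy.
  by split; apply: linked_al => z; apply: (pol2_cong alC ps) => //; apply: als.
- by move=> g x y pg Vx Vy xy; split; apply: stepV => //; apply: bes.
Qed.

Lemma linked_tuples (X : finType) (s : T -> (X -> T) -> T) c d :
  pol1X op s -> (forall y v, e (s y v) = s y v) ->
  (forall j, be (c j) (d j)) -> linked (s^~ c) (s^~ d).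
Proof.
move=> ps es cd.
apply: (upd_ind (x := c) (y := d) (P := fun v => linked (s^~ c) (s^~ v))).
  by apply: linked_al => y; apply: alr.
move=> v k _ vk L; apply: (linked_trans L).
rewrite -{1}(upd_same v k) vk.
apply: (@linked_params (fun y z => s y (upd v k z))) => //.
by move=> Y F G pF pG; apply: ps => // ?; poly_upd.
Qed.

(** The tuples [c] and [d] may leave [V]. In the essential case, linking factors [s^~ c] modulo [al]
    through [s^~ d] and a map [P] with parameters in [V]; since [s^~ d] permutes [V], [tuple_tc] for
    [P] gives the claim. *)
Lemma tuple_tc_outside (X : finType) (s : T -> (X -> T) -> T) a b c d :
  pol1X op s -> (forall y v, e (s y v) = s y v) ->
  e a = a -> e b = b -> be a b -> (forall j, be (c j) (d j)) ->
  al (s a c) (s a d) -> al (s b c) (s b d).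
Proof.
move=> ps es Va Vb ab cd sac.
have psv v : pol1 (s^~ v).
  by move=> Y F pF; apply: ps => // ?; exact: PolyCst.
have inessential v : ~ essential (s^~ v) -> al (s a v) (s b v).
  by move=> ne; apply: contrapT => H; apply: ne; exists a, b.
have [ess|ness] := EM (essential (s^~ c)); last first.
  apply: (alt (y := s a c)); first by apply/als/inessential.
  apply: (alt sac); apply: inessential => ess; apply: ness.
  by case: (linked_tuples ps es (fun j => bes (cd j)) ess).
have [[u [u' [Vu Vu' uu' H]]]] := linked_tuples ps es cd ess.
move=> [Y [P [x [x' [pP eP [Vx Vx'] xx' HP]]]]].
have sN := pol_perm me (psv d) (es^~ d) Vu Vu' uu' H.
have Pa : al (P a x) a.
  have sPa : al (s (P a x) d) (s a d) by apply: alt sac; case: (HP a).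
  have := pol1_cong alC (pol1_iter N.-1 (psv d)) sPa.
  by rewrite !(iter_periodS (s^~ d)) !sN.
have [Pax _] := HP a Va; have [Pbx Pb] := HP b Vb.
have : al (P b x) (P b x').
  by apply: (tuple_tc pP eP Va Vb Vx Vx') => //; rewrite Pax.
rewrite Pbx => /(pol1_cong alC (psv d)) H'.
by apply: alt H'; apply: als.
Qed.

(** Polynomials into [V] detect [al], which brings the values into [V]; the left block changes one
    coordinate at a time, along translates of pairs of [V]. *)
Lemma tc_full (Z X : finType) (S : (Z -> T) -> (X -> T) -> T) a b c d :
  polXX op S -> (forall j, be (a j) (b j)) -> (forall j, be (c j) (d j)) ->
  al (S a c) (S a d) -> al (S b c) (S b d).
Proof.
move=> pS ab cd Sac; apply: (minimal_separates me).
  have pSb : polX op (S b).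
    by move=> Y G pG; apply: pS => // ?; exact: PolyCst.
  exact: (polX_cong beC pSb).
move=> f pf ef.
apply: (upd_ind (x := a) (y := b) (P := fun v => al (f (S v c)) (f (S v d)))).
  exact: (pol1_cong alC pf).
move=> v k _ vk IH; pose s y w := f (S (upd v k y) w).
have ps : pol1X op s.
  by move=> Y F G pF pG; apply: pf; apply: pS => // ?; poly_upd.
have IHk : al (s (a k) c) (s (a k) d) by rewrite /s -vk upd_same.
apply: (proj1 (@cover_generated e
  (fun y y' => al (s y c) (s y d) <-> al (s y' c) (s y' d))
  (mi_sep me) (mi_idem me) (mi_pol me) _ _ _ _ _ _ _ (ab k)) IHk).
- by [].
- by move=> x y H; split=> H'; apply/H.
- by move=> x y z H1 H2; split=> [/H1/H2|/H2/H1].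
- move=> x y xy.
  have xyv v' : al (s x v') (s y v') by apply: (pol1X_cong alC ps).
  split=> H; first by apply: alt (xyv d); apply: alt H; apply/als/xyv.
  by apply: alt (als (xyv d)); apply: alt H; apply: xyv.
- have gen g x y : pol1 g -> e x = x -> e y = y -> be x y ->
      al (s (g x) c) (s (g x) d) -> al (s (g y) c) (s (g y) d).
    move=> pg Vx Vy xy.
    apply: (@tuple_tc_outside _ (fun y => s (g y))) => //.
      by move=> Y F G pF pG; apply: ps => //; apply: pg.
    by move=> y' w; apply: ef.
  by move=> g x y pg Vx Vy xy; split; apply: gen => //; apply: bes.
Qed.

(** If all polynomials into [V] collapse coordinate [k] of [S], then [b = s k] works. Otherwise some
    [f0] makes [S] permute [V] in this coordinate, and [b] comes from inverting. *)
Lemma transport (Y : finType) (S : (Y -> T) -> T) (r s : Y -> T) k a :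
  polX op S -> (forall j, e (r j) = r j) -> (forall j, e (s j) = s j) ->
  (forall j, be (r j) (s j)) -> e a = a -> be (r k) a -> al (S r) (S s) ->
  exists b, [/\ e b = b, be (s k) b & al (S (upd r k a)) (S (upd s k b))].
Proof.
move=> pS Vr Vs rs Va ra Srs.
have pSk f v : pol1 f -> pol1 (fun z => f (S (upd v k z))).
  by move=> pf X F pF; apply: pf; apply: pS => ?; poly_upd.
have bera j : be (r j) (upd r k a j) by rewrite /upd; case: eqP => [->|].
have besb b : be (s k) b -> forall j, be (s j) (upd s k b j).
  by move=> sb j; rewrite /upd; case: eqP => [->|].
have be_upd b : be (s k) b -> forall j, be (upd r k a j) (upd s k b j).
  move=> sb j; apply: bet (besb _ sb j); apply: bet (rs j).
  exact/bes/bera.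
have be_S b : be (s k) b -> be (S (upd r k a)) (S (upd s k b)).
  by move=> sb; apply: (polX_cong beC pS); apply: be_upd.
have [[f0 [pf0 ef0 ess]]|noess] := EM (exists f, [/\ pol1 f,
    forall z, e (f z) = f z & essential (fun z => f (S (upd r k z)))]);
  last first.
  exists (s k); split=> //; rewrite upd_same.
  apply: alt Srs; rewrite -{2}(upd_same r k).
  apply: (minimal_separates me).
    by rewrite upd_same; apply/bes/(polX_cong beC pS).
  move=> f pf ef; apply: contrapT => H; apply: noess; exists f; split=> //.
  by exists a, (r k); split=> //; apply: bes.
pose sg v z := f0 (S (upd v k z)).
have sgN v : (forall j, be (v j) (r j)) ->
    forall z, e z = z -> iter N (sg v) z = z.
  move=> vr; have [u [u' [Vu Vu' uu' H]]] := ess.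
  apply: (pol_perm me (pSk _ v pf0) _ Vu Vu' uu') => [z|H']; first exact: ef0.
  apply: H.
  apply: (@tc_full _ unit (fun v w => sg v (w tt)) v r (fun=> u) (fun=> u')) H'
    => //.
  by move=> X F G pF pG; apply: pf0; apply: pS => ?; poly_upd.
have sgr := sgN r (fun j => ber (r j)).
have sgs := sgN s (fun j => bes (rs j)).
pose b := iter N.-1 (sg s) (sg r a).
have Vb : e b = b by apply: iter_into => [z|]; apply: ef0.
have sb : be (s k) b.
  rewrite /b -{1}(sgs (s k)) // -iter_periodS.
  apply: (pol1_cong beC (pol1_iter N.-1 (pSk f0 s pf0))).
  apply: (pol1_cong beC pf0); rewrite upd_same.
  apply: (polX_cong beC pS) => j; apply: bet (bera j); exact: bes.
exists b; split=> //; apply: (minimal_separates me); first exact: be_S.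
move=> f pf ef.
(* [D] parametrizes coordinate [k] by the value of [f0], so the term condition can change that value
   from [sg r (r k)] to [sg r a] for both tuples at once. *)
pose D (y : unit -> T) v := f (S (upd v k (iter N.-1 (sg v) (y tt)))).
have Dr z : e z = z -> D (fun=> sg r z) r = f (S (upd r k z)).
  by move=> Vz; rewrite /D iter_periodS sgr.
have Ds z : e z = z -> D (fun=> sg s z) s = f (S (upd s k z)).
  by move=> Vz; rewrite /D iter_periodS sgs.
have pD : polXX op D.
  move=> X F G pF pG; apply: pf; apply: (pS) => j.
  rewrite /upd; case: (j == k) => //.
  apply: (poly_iter (s := fun w z => f0 (S (upd (fun y => G y w) k z)))) => //.
  by move=> G' pG'; apply: pf0; apply: pS => ?; poly_upd.
rewrite -(Dr a Va).
apply: (tc_full (a := fun=> sg r (r k)) (b := fun=> sg r a) pD) => //.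
  move=> _; apply: (pol1_cong beC (pSk f0 r pf0)); exact: ra.
rewrite Dr // upd_same; apply: (alt (pol1_cong alC pf Srs)).
rewrite -{1}(upd_same s k) -(Ds _ (Vs k)).
have pDs : pol1 (fun z => D (fun=> z) s).
  by move=> X F pF; apply: pD => // ?; exact: PolyCst.
apply: (pol1_cong alC pDs); rewrite /sg !upd_same.
by apply: (pol1_cong alC pf0); apply: als.
Qed.

(** * Translation digraphs *)

Section Translations.
Variables (n : nat) (p : ('I_n -> T) -> T).
Hypothesis p_pol : polX op p.
Hypothesis p_idem : idempotent_poly p.

Let R := clos_refl_trans T (tr_edge p).
Let E x y := R x y /\ R y x.
Hypothesis alE : forall x y, al x y -> E x y.

Lemma tr_edge_upd c i d : tr_edge p c (p (upd (fun=> c) i d)).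
Proof. by exists i, d. Qed.

(* With [q z = iter N (y |-> p(y,..,z,..,y))], idempotence gives
   [q d (q d b) = q d b = q d (q b b)], and the term condition turns this into
   [q b (q d b)] being [al]-related to [q b b = b]: the walk returns to [b]. *)
Lemma edge_reversible b d i : be b d -> E b (p (upd (fun=> b) i d)).
Proof.
move=> bd; pose phi z y := p (upd (fun=> y) i z).
have pphi (X : Type) (F G : (X -> T) -> T) :
    poly op F -> poly op G -> poly op (fun v => phi (F v) (G v)).
  by move=> pF pG; apply: p_pol => ?; poly_upd.
have Rit z y m : R y (iter m (phi z) y).
  elim: m => [|m IH]; first exact: rt_refl.
  by apply: rt_trans IH _; apply: rt_step; apply: tr_edge_upd.
pose q z y := iter N (phi z) y.
have pq : pol2 q.
  move=> X F G pF pG; apply: (poly_iter (s := fun v => phi (F v))) => // G'.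
  exact: pphi.
have qbb : q b b = b.
  apply: iter_fix; rewrite /phi (_ : upd _ _ _ = fun=> b) ?p_idem //.
  exact: (upd_same (fun=> b)).
have back : al (q b (q d b)) b.
  pose S (z w : unit -> T) := q (z tt) (q (w tt) b).
  have := @tc_full _ _ S (fun=> d) (fun=> b) (fun=> d) (fun=> b).
  rewrite /S qbb qbb; apply; last by rewrite /q iter_period_idem.
  - move=> X F G pF pG; apply: (pq) => //; apply: pq => //; exact: PolyCst.
  - by move=> _; apply: bes.
  - by move=> _; apply: bes.
split; first by apply: rt_step; apply: tr_edge_upd.
apply: (rt_trans _ _ _ (q d b)); first by rewrite /q /N -iter_periodS; apply: Rit.
by apply: (rt_trans _ _ _ (q b (q d b))); [exact: Rit|case: (alE back)].
Qed.

Lemma trace_connected x y : e x = x -> e y = y -> be x y -> E x y.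
Proof.
move=> Vx Vy xy.
pose trace z := e z = z /\ be x z.
pose im (X : finType) (F : (X -> T) -> T) : {set T} :=
  [set b | `[< exists2 v, forall j, trace (v j) & F v = b >]].
pose mk (X : finType) F : {X : finType & (X -> T) -> T} := existT _ X F.
(* The largest image is obtained by minimizing the size of its complement. *)
have [|[X F] [pF Fid] Fmax] := @ex_min_measure _
  (fun F : {X : finType & (X -> T) -> T} =>
     polX op (projT2 F) /\ forall z, projT2 F (fun=> z) = z)
  (fun F => #|T| - #|im _ (projT2 F)|).
  by exists (mk unit (fun v => v tt)); split=> // Y G pG; exact: pG.
rewrite /= in pF Fid.
(* Copies of [F] in disjoint variables: equal copies give back [F], so the image of [F'] contains
   that of [F], and maximality makes them equal. *)
pose F' (w : ('I_n * X)%type -> T) := p (fun i => F (fun l => w (i, l))).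
have pF' : polX op F'.
  by move=> Y G pG; apply: p_pol => i; apply: pF => l; apply: pG.
have F'id z : F' (fun=> z) = z.
  by rewrite /F' -[RHS]p_idem; congr p; apply: funext => i; exact: Fid.
have F'snd v : F' (fun il => v il.2) = F v by rewrite /F' /= p_idem.
have F'im w : (forall j, trace (w j)) ->
    exists2 v, forall j, trace (v j) & F v = F' w.
  move=> tw.
  have sub : im X F \subset im ('I_n * X)%type F'.
    apply/subsetP => b; rewrite !inE => /asboolP[v tv <-]; apply/asboolP.
    by exists (fun il => v il.2) => // j; apply: tv.
  have /eqP eq_im : im X F == im ('I_n * X)%type F'.
    rewrite eqEcard sub /=.
    have := Fmax (mk ('I_n * X)%type F') (conj pF' F'id).
    by rewrite leq_sub2lE // max_card.
  have : F' w \in im ('I_n * X)%type F'.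
    by rewrite inE; apply/asboolP; exists w.
  by rewrite -eq_im inE => /asboolP.
rewrite -(F'id x) -(F'id y).
have Er z : E z z by split; apply: rt_refl.
have Et u v w : E u v -> E v w -> E u w.
  by move=> [H1 H2] [H3 H4]; split; apply: rt_trans; eassumption.
apply: (upd_ind (x := fun=> x) (y := fun=> y)
          (P := fun w => E (F' (fun=> x)) (F' w))) => // w [i l] tw' _ IH.
apply: (Et _ _ _ IH).
have tw j : trace (w j) by case: (tw' j) => ->.
have [v tv Fv] := F'im w tw.
(* Repeating [v] in every block gives the same value as [w]. The change of [w] is transported to
   block [i] of that tuple, where it becomes an edge from [F v]. *)
have [||||||a [Va va Sa]] := @transport _ F' w (fun il => v il.2) (i, l) y pF'.
- by move=> j; case: (tw j).
- by move=> j; case: (tv j.2).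
- move=> j; case: (tw j) => _ H; case: (tv j.2) => _; apply: bet; exact: bes.
- exact: Vy.
- by apply: bet xy; apply: bes; case: (tw (i, l)).
- by rewrite F'snd Fv; apply: alr.
move: Sa; rewrite (_ : F' (upd (fun il => v il.2) (i, l) a) =
                       p (upd (fun=> F v) i (F (upd v l a)))); last first.
  rewrite /F'; congr p; apply: funext => i'; rewrite /upd.
  case: eqP => [->|ne]; congr F; apply: funext => l'.
    by rewrite xpair_eqE eqxx.
  by rewrite xpair_eqE; case: eqP.
rewrite Fv => /als/alE; apply: Et; apply: edge_reversible.
rewrite -Fv; apply: (polX_cong beC pF) => j.
by rewrite /upd; case: eqP => [->|].
Qed.

End Translations.

End TermCondition.

Lemma centralizes_of_no_snag : ~ snag op -> centralizes op be be al.
Proof.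
move=> nosnag m k t a b c d ab cd.
have [e me] := minimal_idem_exists.
apply: (tc_full me (single_tc_of_no_snag me nosnag)
  (S := fun a c => teval op t (tconcat a c))) => //.
move=> X F G pF pG; elim: t => [j|i args IH] /=; last exact: PolyApp.
by rewrite /tconcat; case: (split j).
Qed.

(** Only translated pairs [g x], [g y] of points of [V] need connecting; unless [al]-related, they
    lie in a minimal neighborhood of their own. *)
Lemma cover_connected n (p : ('I_n -> T) -> T) :
  ~ snag op -> polX op p -> idempotent_poly p ->
  let E x y := clos_refl_trans T (tr_edge p) x y /\
               clos_refl_trans T (tr_edge p) y x in
  (forall x y, al x y -> E x y) -> forall x y, be x y -> E x y.
Proof.
move=> nosnag p_pol p_idem E alE.
have [e me] := minimal_idem_exists.
have [pe ee _ emin] := me.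
apply: (cover_generated (mi_sep me) ee pe) => //.
- by move=> x; split; apply: rt_refl.
- by move=> x y [].
- by move=> x y z [H1 H2] [H3 H4]; split; apply: rt_trans; eassumption.
move=> g x y pg Vx Vy xy.
have [|nal] := EM (al (g x) (g y)); first exact: alE.
have gxy : be (g x) (g y) by apply: (pol1_cong beC).
have [f pf nf] := separate_again pe (mi_sep me) gxy nal.
pose rho z := e (f (g z)).
have prho : pol1 rho := pol1_comp pe (pol1_comp pf pg).
have rhoN := pol_perm me prho (fun z => ee _) Vx Vy xy nf.
(* [g] carries the minimal image of [e] onto the minimal image of [e']. *)
pose e' z := g (iter N.-1 rho (e (f z))).
have Vit z : e (iter N.-1 rho (e (f z))) = iter N.-1 rho (e (f z)).
  by apply: iter_into => // u; apply: ee.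
have e'g z : e z = z -> e' (g z) = g z.
  by move=> Vz; rewrite /e' -/(rho z) iter_periodS rhoN.
have e'e' z : e' (e' z) = e' z by rewrite [e' z]/e' e'g.
have me' : minimal_idem e'.
  split=> //.
  - apply: (pol1_comp pg); apply: (pol1_comp (pol1_iter _ prho)).
    exact: (pol1_comp pe pf).
  - by exists (g x), (g y); rewrite !e'g.
  - move=> h ph sh; apply: leq_trans (emin h ph sh).
    apply: (leq_trans _ (leq_imset_card g [set e z | z : T])).
    apply/subset_leq_card/subsetP => _ /imsetP[z _ ->].
    by rewrite /e'; apply: imset_f; rewrite -Vit; apply: imset_f.
apply: (trace_connected me' (single_tc_of_no_snag me' nosnag)) => //.
  exact: e'g.
exact: e'g.
Qed.

End Cover.

(** * Solvability and induced algebras *)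

Section Solvability.
Variables (T : finType) (I : Type) (ar : I -> nat).
Variable op : forall i : I, ('I_(ar i) -> T) -> T.

Lemma lower_cover (be : T -> T -> Prop) : is_cong op be ->
  (exists x y, be x y /\ x <> y) -> exists al, covers op al be.
Proof.
move=> beC [x0 [y0 [bxy nxy]]].
have ber x : be x x by case: beC.
have [|al [alC al_be be_al] almax] := @ex_min_measure _
  (fun al => [/\ is_cong op al, forall x y, al x y -> be x y &
                 exists x y, be x y /\ ~ al x y])
  (fun al => #|{: T * T}| - rcard al).
  exists eq; split=> [|x y ->//|]; last by exists x0, y0.
  split=> [//|]; split=> [//|]; split=> [x y z -> //|i x y xy].
  by congr op; apply: funext.
exists al; split=> // ga gaC al_ga ga_be.
have [H|H] := EM (exists x y, be x y /\ ~ ga x y); [left|right].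
  have le : rcard ga <= rcard al.
    by have := almax ga (And3 gaC ga_be H); rewrite leq_sub2lE // max_card.
  exact: (rcard_sub_eq al_ga le).
move=> x y xy; apply: contrapT => ng; apply: H; by exists x, y.
Qed.

Lemma commutator_cong be : is_cong op (commutator op be be).
Proof.
split; [|split; [|split]].
- by move=> x de [r _] _; apply: r.
- by move=> x y H de deC cde; have [_ [s _]] := deC; apply: s; apply: H.
- move=> x y z H H' de deC cde; have [_ [_ [t _]]] := deC.
  by apply: (t _ y); [apply: H|apply: H'].
- move=> i x y H de deC cde; have [_ [_ [_ o]]] := deC.
  by apply: o => k; apply: H.
Qed.

Lemma derived_cong k : is_cong op (derived op k).
Proof. by case: k => [|k]; [split|apply: commutator_cong]. Qed.

(** A member of the derived series with fewest pairs is equality: otherwise the next member would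
    lie inside a lower cover and have fewer pairs. *)
Lemma solvable_of_no_snag : ~ snag op -> solvable op.
Proof.
move=> nosnag.
have [|k _ kmin] := @ex_min_measure nat (fun=> True)
  (fun k => rcard (derived op k)); first by exists 0.
exists k => x y; split=> [xy|->]; last by case: (derived_cong k).
apply: contrapT => nxy.
have [|al cov] := lower_cover (derived_cong k); first by exists x, y.
have sub u v : derived op k.+1 u v -> al u v.
  apply; first exact: covers_cong_lo cov.
  exact: centralizes_of_no_snag nosnag.
have [u [v [uv []]]] := covers_strict cov.
apply: (sub); apply: rcard_sub_eq uv; last exact: kmin.
by move=> a b /sub; apply: (covers_sub cov).
Qed.

(** Centrality speaks of terms, so constants become variables: [k a] is the one reserved for the
    value [a]. *)
Lemma poly_term (X : Type) (F : (X -> T) -> T) n (j : X -> 'I_n) (k : T -> 'I_n) :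
  poly op F -> exists t : term ar n, forall v w,
    (forall x, w (j x) = v x) -> (forall a, w (k a) = a) -> teval op t w = F v.
Proof.
elim=> [x|a|i G _ IH].
- by exists (TVar ar (j x)) => v w Hj _; exact: Hj.
- by exists (TVar ar (k a)) => v w _ Hk; exact: Hk.
- have {IH}[t Ht] := fin_all_exists IH.
  exists (TApp t) => v w Hj Hk /=; congr op; apply: funext => l; exact: Ht.
Qed.

Lemma no_snag_of_solvable : solvable op -> ~ snag op.
Proof.
move=> [d sol] [s [a [b [ps nab saa sab [sba sbb]]]]]; apply/nab/sol.
elim: d {sol} => [//|d IH] de deC cde.
have pF : poly op (fun v : bool -> T => s (v true) (v false)).
  by apply: ps; exact: PolyVar.
(* The first block holds the first argument of [s] and a slot for each constant; the constants agree
   on both sides, so only the pair [a], [b] matters. *)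
pose m := (1 + #|T|)%N.
pose j (x : bool) : 'I_(m + 1) :=
  if x then lshift 1 (lshift #|T| (ord0 : 'I_1)) else rshift m (ord0 : 'I_1).
pose k (x : T) : 'I_(m + 1) := lshift 1 (rshift 1 (enum_rank x)).
have [t Ht] := poly_term j k pF.
pose lhs (x : T) : 'I_m -> T := tconcat (fun _ : 'I_1 => x) (@enum_val T predT).
have tE x y : teval op t (tconcat (lhs x) (fun _ : 'I_1 => y)) = s x y.
  apply: (Ht (fun x' => if x' then x else y)) => [[]|c].
  - by rewrite /j /tconcat (unsplitK (inl _)) /lhs /tconcat (unsplitK (inl _)).
  - by rewrite /j /tconcat (unsplitK (inr _)).
  - rewrite /k /tconcat (unsplitK (inl _)) /lhs /tconcat (unsplitK (inr _)).
    exact: enum_rankK.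
have derr x : de x x by case: deC.
have := cde m 1 t (lhs a) (lhs b) (fun=> a) (fun=> b).
rewrite !tE saa sab sba sbb; apply=> // l.
rewrite /lhs /tconcat; case: (split l) => // l'.
exact: (proj1 (derived_cong d)).
Qed.

(** A congruence with fewest pairs among those not inside mutual reachability has its lower covers
    inside it. *)
Lemma strongly_connected_of_no_snag n (p : ('I_n -> T) -> T) :
  ~ snag op -> polX op p -> idempotent_poly p -> strongly_connected (tr_edge p).
Proof.
move=> nosnag p_pol p_idem u v; apply: contrapT => nuv.
pose E x y := clos_refl_trans T (tr_edge p) x y /\
              clos_refl_trans T (tr_edge p) y x.
have [|be [beC [x [y [xy nxy]]]] bemin] := @ex_min_measure _
  (fun be => is_cong op be /\ exists x y, be x y /\ ~ E x y) (@rcard T).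
  exists (fun _ _ => True); split; first by split.
  by exists u, v; split=> // -[].
have [|al cov] := lower_cover beC.
  exists x, y; split=> // eqxy; apply: nxy.
  by rewrite eqxy; split; apply: rt_refl.
apply: nxy; apply: (cover_connected cov nosnag p_pol p_idem) xy => a b ab.
apply: contrapT => nE.
have le : rcard be <= rcard al.
  by apply: bemin; split; [exact: covers_cong_lo cov|exists a, b].
have [x' [y' [bxy []]]] := covers_strict cov.
exact: (rcard_sub_eq (covers_sub cov) le).
Qed.

Lemma is_polyP n (f : ('I_n -> T) -> T) : is_poly op f <-> poly op f.
Proof.
split=> [[t ft]|].
  rewrite (_ : f = peval op t); last exact: funext.
  by elim: t {f ft} => [j|c|i args IH] /=;
    [exact: PolyVar|exact: PolyCst|exact: PolyApp].
elim=> [j|c|i G _ IH].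
- by exists (PVar T ar j).
- by exists (PCst ar n c).
- have {IH}[t Ht] := fin_all_exists IH.
  by exists (PApp t) => x /=; congr op; apply: funext => l; apply: Ht.
Qed.

End Solvability.

(** * Neighborhoods and induced algebras *)

Section InducedAlgebra.
Variables (A : finType) (I : Type) (ar : I -> nat).
Variable op : forall i : I, ('I_(ar i) -> A) -> A.

Lemma poly_induced (U : {set A}) (X : Type)
    (F : (X -> {a : A | a \in U}) -> {a : A | a \in U}) :
  poly (@ind_op A I ar op U) F -> exists2 G, poly op G &
    forall v, sval (F v) = G (fun x => sval (v x)).
Proof.
elim=> [x|c|s G _ IH].
- by exists (fun v => v x); [exact: PolyVar|].
- by exists (fun=> sval c); [exact: PolyCst|].
- have {}IH k : exists H, poly op H /\
      forall v, sval (G k v) = H (fun x => sval (v x)).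
    by case: (IH k) => H; exists H.
  have {IH}[H HG] := fin_all_exists IH.
  have [f_poly _] := svalP (projT2 s).
  exists (fun v => sval (projT2 s) (fun k => H k v)).
    have /is_polyP/poly_polX pf := f_poly.
    by apply: pf => k; case: (HG k).
  move=> v /=; congr (sval (projT2 s) _).
  by apply: funext => k; case: (HG k) => _ ->.
Qed.

Lemma no_snag_induced (U : {set A}) :
  ~ snag op -> ~ @snag {a : A | a \in U} _ _ (@ind_op A I ar op U).
Proof.
move=> nosnag [s [a [b [ps nab saa sab [sba sbb]]]]]; apply: nosnag.
have [|G pG EG] := @poly_induced U bool (fun v => s (v true) (v false)).
  by apply: ps; exact: PolyVar.
pose s' x y := G (fun c => if c then x else y).
have s's x y : s' (sval x) (sval y) = sval (s x y).
  rewrite (EG (fun c => if c then x else y)).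
  by congr G; apply: funext; case.
exists s', (sval a), (sval b); rewrite !s's saa sab sba sbb; split=> //.
  move=> X F H pF pH.
  by apply: (poly_polX pG (G := fun c v => if c then F v else H v)); case.
by move=> /val_inj.
Qed.

Lemma no_snag_of_connected :
  (forall e : A -> A, nbhd_map op e ->
   forall (n : nat) (p : ('I_n -> ind_carrier (nbhd e)) -> ind_carrier (nbhd e)),
     is_poly (@ind_op A I ar op (nbhd e)) p -> idempotent_poly p ->
     strongly_connected (tr_edge p)) ->
  ~ snag op.
Proof.
move=> conn [s [a [b [ps nab saa sab [sba sbb]]]]].
pose N := period A.
have [|e [pe ee [ea eb]] emin] := @ex_min_measure _
  (fun e => [/\ pol1 op e, forall x, e (e x) = e x & e a = a /\ e b = b])
  (fun e => #|[set e x | x : A]|).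
  by exists id; split; [exact: pol1_id|..].
have perm g : pol1 op g -> (forall z, e (g z) = g z) -> g a = a -> g b = b ->
    forall z, e z = z -> iter N g z = z.
  move=> pg eg ga gb z Vz.
  have sub : [set iter N g x | x : A] \subset [set e x | x : A].
    apply/subsetP => _ /imsetP[x _ ->]; apply/imsetP.
    exists (iter N g x) => //.
    by rewrite /N -iter_periodS iter_into.
  have /eqP im : [set iter N g x | x : A] == [set e x | x : A].
    rewrite eqEcard sub; apply: emin; split.
    - exact: pol1_iter.
    - exact: iter_period_idem.
    - by rewrite !iter_fix.
  have : z \in [set iter N g x | x : A] by rewrite im -Vz imset_f.
  by move=> /imsetP[x _ ->]; apply: iter_period_idem.
pose g x := e (s x x).
have pg : pol1 op g by move=> X F pF; apply: pe; apply: ps.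
have gN z : e z = z -> iter N g z = z.
  by apply: perm => // [z'||]; rewrite /g ?ee ?saa ?sbb.
have ga : g a = a by rewrite /g saa.
have gb : g b = b by rewrite /g sbb.
(* Undoing the diagonal [g] makes [q0] idempotent on [V] and keeps the snag values, as [g] fixes [a]
   and [b]. *)
pose q0 x y := iter N.-1 g (e (s x y)).
have pq0 : pol2 op q0.
  move=> X F G pF pG; apply: (poly_iter (s := fun=> g)).
    by move=> ?; apply: pg.
  by apply: pe; apply: ps.
have eq0 x y : e (q0 x y) = q0 x y.
  by apply: iter_into => [z|]; apply: ee.
have q0id x : e x = x -> q0 x x = x.
  by move=> Vx; rewrite /q0 -/(g x) iter_periodS gN.
pose q x y := iter N (q0 x) y.
have pq : pol2 op q.
  move=> X F G pF pG; apply: (poly_iter (s := fun v => q0 (F v))) => // ?.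
  exact: pq0.
have eq x y : e (q x y) = q x y by rewrite /q /N -iter_periodS iter_into.
have qid x : e x = x -> q x x = x by move=> Vx; apply/iter_fix/q0id.
have qb y : e y = y -> q b y = y.
  apply: perm => //.
  - by move=> X F pF; apply: pq0 => //; exact: PolyCst.
  - by rewrite /q0 sba ea iter_fix.
  - by rewrite /q0 sbb eb iter_fix.
have qab : q a b = a.
  rewrite /q /N -iter_periodS (_ : q0 a b = a) ?iter_fix ?q0id //.
  by rewrite /q0 sab ea iter_fix.
(* [q x y = b] forces [q x b = b], since [q x] is idempotent; as [q^~ b] permutes [V] and fixes [b],
   this gives [x = b]. *)
have q_eq_b x y : e x = x -> e y = y -> q x y = b -> x = b /\ y = b.
  move=> Vx Vy qxy.
  have qxb : q x b = b.
    by rewrite -{1}qxy; rewrite /q iter_period_idem.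
  have xb : x = b.
    have qbN : forall z, e z = z -> iter N (q^~ b) z = z.
      apply: perm => //; last exact: qid.
      by move=> X F pF; apply: pq => //; exact: PolyCst.
    rewrite -(qbN x Vx) -[RHS](qbN b eb) /N -!(iter_periodS (q^~ b)).
    by rewrite qxb qid.
  by split=> //; rewrite -qxy xb qb.
have inU x : (x \in nbhd e) <-> e x = x.
  by split=> [/imsetP[z _ ->]//|<-]; apply: imset_f.
have eP : nbhd_map op e.
  by split=> //; apply/is_polyP; apply: pe; exact: PolyVar.
pose f (x : 'I_2 -> A) := q (x ord0) (x ord_max).
have fP : is_poly op f /\ preserves (nbhd e) f.
  split; last by move=> x _; apply/inU; apply: eq.
  by apply/is_polyP; apply: pq; exact: PolyVar.
pose idx : ind_idx op (nbhd e) := existT _ 2 (exist _ f fP).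
pose p : ('I_2 -> ind_carrier (nbhd e)) -> ind_carrier (nbhd e) :=
  @ind_op A I ar op (nbhd e) idx.
have p_poly : is_poly (@ind_op A I ar op (nbhd e)) p.
  by exists (PApp (i := idx) (fun k => PVar _ _ k)).
have p_idem : idempotent_poly p.
  by move=> x; apply: val_inj; apply: qid; apply/inU; exact: (svalP x).
have aU : a \in nbhd e by apply/inU.
have bU : b \in nbhd e by apply/inU.
have := conn e eP 2 p p_poly p_idem (exist _ a aU) (exist _ b bU).
have Vs (w : ind_carrier (nbhd e)) : e (sval w) = sval w.
  by apply/inU; exact: (svalP w).
(* An edge changes one of two arguments and keeps its source in the other, so an edge into [b]
   starts at [b]. *)
have stay u v : clos_refl_trans _ (tr_edge p) u v -> sval v = b -> sval u = b.
  elim=> {u v} [c v [j [d ->]]|//|u v w _ IH1 _ IH2 /IH2/IH1//].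
  move=> /(q_eq_b _ _ (Vs _) (Vs _))[].
  by case: (ord0 =P j) => [<- _|_ -> //].
by move=> /stay /(_ erefl).
Qed.

End InducedAlgebra.

Theorem theorem3p2 (A : finType) (I : Type) (ar : I -> nat)
    (op : forall i : I, ('I_(ar i) -> A) -> A) :
  solvable op <->
  (forall e : A -> A, nbhd_map op e ->
   forall (n : nat) (p : ('I_n -> ind_carrier (nbhd e)) -> ind_carrier (nbhd e)),
     is_poly (@ind_op A I ar op (nbhd e)) p -> idempotent_poly p ->
     strongly_connected (tr_edge p)).
Proof.
split=> [/no_snag_of_solvable nosnag e _ n p p_poly p_idem|conn].
  apply: (strongly_connected_of_no_snag (no_snag_induced (U := nbhd e) nosnag)).
    by apply/poly_polX/is_polyP.
  exact: p_idem.
exact/solvable_of_no_snag/no_snag_of_connected.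
Qed.
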